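(* Let $p$ be an odd prime and $n\ge 1$. (1) Let $1\le i<n$. Then for $0\le s<n$, $\delta_i(Q_{n,s})=(-1)^{n+i-1}$ if $s=i$ and $\delta_i(Q_{n,s})=0$ if $s\ne i$; and, for every integer $m\ge 1$, $$\delta_i^{\,m}(Q_{n,s})=\begin{cases}(-1)^{n+i-1},& m=1\text{ and }s=i,\\ 0,&\text{otherwise.}\end{cases}$$ Consequently, $$(\mathrm{St}^{\Delta_i})^{m}(Q_{n,s})=\begin{cases}(-1)^{i-1}Q_{n,0},& m=1\text{ and }s=i,\\ 0,&\text{otherwise.}\end{cases}$$ (2) For $i=n$, one has $\delta_n(Q_{n,s})=Q_{n,s}$ for $0\le s<n$, hence $\delta_n^{\,m}(Q_{n,s})=Q_{n,s}$ for $m\ge 1$, and $$(\mathrm{St}^{\Delta_n})^{m}(Q_{n,s})=(-1)^{mn}\,m!\,Q_{n,0}^{\,m}Q_{n,s}\qquad(m\ge 1).$$ In particular, $(\mathrm{St}^{\Delta_n})^{m}(Q_{n,s})=0$ for $m\ge p$.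
   Context: Let $p$ be an odd prime, $n\ge 1$, and $P_n=\mathbb{F}_p[x_1,\dots,x_n]$. For integers $e_1,\dots,e_n\ge 0$ put $[e_1,\dots,e_n]:=\det\big(x_r^{p^{e_s}}\big)_{1\le r,s\le n}\in P_n$. Let $L_n=[0,1,\dots,n-1]$ and $L_{n,s}=[0,1,\dots,\widehat{s},\dots,n]$ for $0\le s<n$ (a hat means omission). The Dickson invariants are $Q_{n,s}=L_{n,s}/L_n$ $(0\le s<n)$; in particular $Q_{n,0}=L_n^{p-1}$. The Dickson algebra is $D_n=P_n^{\mathrm{GL}_n(\mathbb{F}_p)}=\mathbb{F}_p[Q_{n,0},\dots,Q_{n,n-1}]$, a polynomial algebra on these generators. For $i\ge1$, $\mathrm{St}^{\Delta_i}$ denotes the Steenrod--Milnor operation dual to the monomial $\xi_i$ in Milnor's dual mod-$p$ Steenrod algebra. It acts on $P_n$ as the unique $\mathbb{F}_p$-linear derivation with $\mathrm{St}^{\Delta_i}(x_r)=x_r^{p^i}$ $(1\le r\le n)$, and it maps $D_n$ into $D_n$. On a localization of $D_n$, $\mathrm{St}^{\Delta_i}$ means the unique derivation extending $\mathrm{St}^{\Delta_i}|_{D_n}$. The normalized derivation is $\delta_i:=(-1)^nQ_{n,0}^{-1}\mathrm{St}^{\Delta_i}$ on $D_n[Q_{n,0}^{-1}]$; it maps $D_n$ into $D_n$. Powers of operators denote iterated composition. *)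

(* Defs.v *)
From HB Require Import structures.
From mathcomp Require Import all_boot all_order all_algebra.
From mathcomp Require Import all_field.
From mathcomp Require Import boolp mpoly ring.

Set Implicit Arguments.
Unset Strict Implicit.
Unset Printing Implicit Defensive.

Import GRing.Theory.
Local Open Scope ring_scope.

Definition is_derivation (R : pzRingType) (d : R -> R) : Prop :=
  {morph d : x y / x + y} /\ forall x y, d (x * y) = d x * y + x * d y.

Section DerivationTheory.
Variables (R : comPzRingType) (d : R -> R).
Hypothesis hd : is_derivation d.

Lemma der0 : d 0 = 0.
Proof. by apply: (addIr (d 0)); rewrite -hd.1 !add0r. Qed.

Lemma derN x : d (- x) = - d x.
Proof. by apply: (addIr (d x)); rewrite -hd.1 !addNr der0. Qed.

Lemma der1 : d 1 = 0.
Proof.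
by apply: (addIr (d 1)); rewrite add0r -{3}[1]mulr1 hd.2 mulr1 mul1r.
Qed.

(* A form of d (a ^+ k) = k a ^+ (k - 1) d a without a predecessor. *)
Lemma derX a k : a * d (a ^+ k) = k%:R * a ^+ k * d a.
Proof.
elim: k => [|k IH]; first by rewrite der1 mulr0 !mul0r.
by rewrite exprS hd.2 IH -nat1r; ring.
Qed.
End DerivationTheory.

(* R[1/a], realized inside the fraction field of R (for a != 0). *)
Section Localization.
Variables (R : idomainType) (a : R).

Local Notation "x %:F" := (@FracField.tofrac R x).

Definition loc_pred : {pred {fraction R}} := fun z =>
  asbool (exists bk : R * nat, z = bk.1%:F / a%:F ^+ bk.2).

Lemma loc_predP z :
  reflect (exists b k, z = b%:F / a%:F ^+ k) (z \in loc_pred).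
Proof.
apply: (iffP (asboolP _)) => [[[b k] ->]|[b [k ->]]]; first by exists b, k.
by exists (b, k).
Qed.

Lemma loc_pred_subring : subring_closed loc_pred.
Proof.
have [a0|a0] := eqVneq a 0.
  have H z : reflect (exists b, z = b%:F) (z \in loc_pred).
    apply: (iffP (loc_predP z)) => [[b [[|k] ->]]|[b ->]].
    - by exists b; rewrite expr0 divr1.
    - by exists 0; rewrite a0 tofrac0 expr0n /= invr0 mulr0.
    - by exists b, 0; rewrite expr0 divr1.
  split=> [|x y /H[b ->] /H[c ->]|x y /H[b ->] /H[c ->]]; apply/H.
  - by exists 1; rewrite tofrac1.
  - by exists (b - c); rewrite tofracB.
  - by exists (b * c); rewrite tofracM.
have aF k : a%:F ^+ k != 0 by rewrite expf_neq0 // tofrac_eq0.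
split=> [|x y /loc_predP[b [k ->]] /loc_predP[c [l ->]]
         |x y /loc_predP[b [k ->]] /loc_predP[c [l ->]]]; apply/loc_predP.
- by exists 1, 0; rewrite tofrac1 divr1.
- exists (b * a ^+ l - c * a ^+ k), (k + l)%N.
  by rewrite tofracB !tofracM !tofracXn exprD -mulNr addf_div // mulNr.
- exists (b * c), (k + l)%N.
  by rewrite tofracM exprD mulf_div.
Qed.

HB.instance Definition _ :=
  GRing.isSubringClosed.Build {fraction R} loc_pred loc_pred_subring.

Record localization :=
  Localization { loc_val :> {fraction R}; loc_valP : loc_val \in loc_pred }.

HB.instance Definition _ := [isSub for loc_val].
HB.instance Definition _ := [Choice of localization by <:].
HB.instance Definition _ :=
  [SubChoice_isSubComNzRing of localization by <:].

Lemma loc_frac_subproof b k : b%:F / a%:F ^+ k \in loc_pred.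
Proof. by apply/loc_predP; exists b, k. Qed.

Definition loc_frac b k : localization := Localization (loc_frac_subproof b k).

Definition loc_inj b : localization := loc_frac b 0.
Definition loc_inv : localization := loc_frac 1 1.

Lemma loc_fracP (z : localization) :
  exists bk : R * nat, z == loc_frac bk.1 bk.2.
Proof.
have [b [k e]] := loc_predP _ (valP z).
by exists (b, k); apply/eqP/val_inj.
Qed.

Lemma loc_injE b : val (loc_inj b) = b%:F.
Proof. by rewrite /= expr0 divr1. Qed.

Lemma loc_inj_zmod_morphism : zmod_morphism loc_inj.
Proof.
move=> x y; apply/val_inj; rewrite loc_injE raddfB /=.
by rewrite !expr0 !divr1.
Qed.

Lemma loc_inj_monoid_morphism : monoid_morphism loc_inj.
Proof.
split=> [|x y]; apply/val_inj; first by rewrite loc_injE tofrac1.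
by rewrite loc_injE tofracM rmorphM /= !expr0 !divr1.
Qed.

HB.instance Definition _ :=
  GRing.isZmodMorphism.Build R localization loc_inj loc_inj_zmod_morphism.
HB.instance Definition _ :=
  GRing.isMonoidMorphism.Build R localization loc_inj loc_inj_monoid_morphism.

(* The quotient rule d (b / a^k) = (a (d b) - k b (d a)) / a^(k+1), applied to
   a chosen representative. *)
Definition loc_der (d : R -> R) (z : localization) : localization :=
  let: (b, k) := xchoose (loc_fracP z) in
  loc_frac (a * d b - k%:R * (b * d a)) k.+1.

Section Theory.
Hypothesis a0 : a != 0.

Let aF k : a%:F ^+ k != 0. Proof. by rewrite expf_neq0 // tofrac_eq0. Qed.

Lemma loc_invK : loc_inv * loc_inj a = 1.
Proof.
apply/val_inj; rewrite rmorphM rmorph1 /= tofrac1 div1r expr1 expr0 divr1.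
by rewrite mulVf // tofrac_eq0.
Qed.

Lemma loc_frac_eq b k c l :
  loc_frac b k = loc_frac c l <-> b * a ^+ l = c * a ^+ k.
Proof.
split=> [/(congr1 val)/=/eqP|e].
  by rewrite eqr_div // -!tofracXn -!tofracM tofrac_eq => /eqP.
by apply/val_inj/eqP; rewrite /= eqr_div // -!tofracXn -!tofracM e.
Qed.

Lemma loc_fracD b k c l :
  loc_frac b k + loc_frac c l =
  loc_frac (b * a ^+ l + c * a ^+ k) (k + l).
Proof.
apply/val_inj; rewrite raddfD /= tofracD !tofracM !tofracXn exprD.
by rewrite addf_div.
Qed.

Lemma loc_fracM b k c l :
  loc_frac b k * loc_frac c l = loc_frac (b * c) (k + l).
Proof. by apply/val_inj; rewrite rmorphM /= tofracM exprD mulf_div. Qed.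

Variable d : R -> R.
Hypothesis hd : is_derivation d.

Let dX b k : a * (b * d (a ^+ k)) = b * (k%:R * a ^+ k * d a).
Proof. by rewrite mulrCA derX. Qed.

Lemma loc_der_frac b k :
  loc_der d (loc_frac b k) = loc_frac (a * d b - k%:R * (b * d a)) k.+1.
Proof.
rewrite /loc_der; case: (xchoose _) (xchooseP (loc_fracP (loc_frac b k))).
move=> c l /= /eqP /loc_frac_eq e; apply/loc_frac_eq.
have de := congr1 (fun x => a * d x) e.
rewrite /= !hd.2 !mulrDr !dX in de.
rewrite !exprS; apply/eqP; rewrite -subr_eq0; apply/eqP.
transitivity (a * ((a * (d c * a ^+ k) + c * (k%:R * a ^+ k * d a))
  - (a * (d b * a ^+ l) + b * (l%:R * a ^+ l * d a))
  + (l%:R + k%:R) * d a * (b * a ^+ l - c * a ^+ k))); first by ring.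
by rewrite -de e !subrr !(mulr0, addr0).
Qed.

Lemma loc_der_inj b : loc_der d (loc_inj b) = loc_inj (d b).
Proof.
rewrite loc_der_frac; apply/loc_frac_eq.
by rewrite mul0r subr0 expr0 mulr1 expr1 mulrC.
Qed.

Lemma loc_der_derivation : is_derivation (loc_der d).
Proof.
split=> x y; have [[b k] /= /eqP ->] := loc_fracP x;
    have [[c l] /= /eqP ->] := loc_fracP y.
  rewrite loc_fracD !loc_der_frac loc_fracD; apply/loc_frac_eq.
  rewrite !hd.1 !hd.2 !mulrDr !dX.
  by rewrite natrD !(addSn, addnS, exprS, exprD); ring.
rewrite loc_fracM !loc_der_frac !loc_fracM loc_fracD; apply/loc_frac_eq.
rewrite !hd.2 natrD !(addSn, addnS, exprS, exprD); ring.
Qed.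

Lemma loc_der_unique (D : localization -> localization) :
  is_derivation D -> (forall b, D (loc_inj b) = loc_inj (d b)) ->
  D =1 loc_der d.
Proof.
move=> hD DE z; have [[b k] /= /eqP zE] := loc_fracP z.
have zK : z * loc_inj (a ^+ k) = loc_inj b.
  by rewrite zE loc_fracM; apply/loc_frac_eq; rewrite expr0 mulr1 addn0.
have ik : loc_frac 1 k * loc_inj (a ^+ k) = 1.
  rewrite loc_fracM -(rmorph1 loc_inj); apply/loc_frac_eq.
  by rewrite expr0 mulr1 addn0.
apply: (can_inj (g := fun t => t * loc_frac 1 k) (f := *%R^~ (loc_inj (a ^+ k)))).
  by move=> t /=; rewrite -mulrA [_ * loc_frac _ _]mulrC ik mulr1.
apply: (addIr (z * loc_inj (d (a ^+ k)))); rewrite -{1}DE -hD.2 zK DE.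
by rewrite -loc_der_inj -zK loc_der_derivation.2 loc_der_inj.
Qed.
End Theory.
End Localization.

Section PolyDerivation.
Variables (p n : nat).
Local Notation P := {mpoly 'F_p[n]}.

Lemma mpoly_skew_der_ext (phi : {rmorphism P -> P}) (D1 D2 : P -> P) :
    {morph D1 : x y / x + y} -> {morph D2 : x y / x + y} ->
    (forall x y, D1 (x * y) = D1 x * phi y + phi x * D1 y) ->
    (forall x y, D2 (x * y) = D2 x * phi y + phi x * D2 y) ->
  (forall r, D1 'X_r = D2 'X_r) -> D1 =1 D2.
Proof.
move=> a1 a2 m1 m2 e.
have z (D : P -> P) : {morph D : x y / x + y} -> D 0 = 0.
  by move=> aD; apply: (addIr (D 0)); rewrite -aD !add0r.
have o (D : P -> P) : (forall x y, D (x * y) = D x * phi y + phi x * D y) -> D 1 = 0.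
  move=> mD; apply: (addIr (D 1)); rewrite add0r -{3}[1]mulr1 mD.
  by rewrite rmorph1 mulr1 mul1r.
have eN k : D1 k%:R = D2 k%:R.
  by elim: k => [|k IH]; rewrite ?z // -nat1r a1 a2 IH !o.
have eM x y : D1 x = D2 x -> D1 y = D2 y -> D1 (x * y) = D2 (x * y).
  by move=> ex ey; rewrite m1 m2 ex ey.
have e1 : D1 1 = D2 1 by rewrite !o.
elim/mpolyind => [|c m f _ _ IH]; first by rewrite !z.
rewrite a1 a2 IH; congr (_ + _); rewrite -mul_mpolyC.
apply: (eM); first by rewrite -[c]natr_Zp rmorph_nat.
rewrite mpolyXE_id; apply: (@big_ind _ (fun f => D1 f = D2 f)) => [|x y|r _]; [exact: e1|exact: eM|].
by elim: (m r) => [|k IHk] //; rewrite exprS; apply: (eM).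
Qed.

(* St^{Delta_i}, the derivation with 'X_r |-> 'X_r ^ (p ^ i). *)
Definition St (i : nat) (f : P) : P := \sum_(r < n) 'X_r ^+ (p ^ i) * f^`M(r).

Lemma St_derivation i : is_derivation (St i).
Proof.
split=> f g; rewrite /St.
  by rewrite -big_split /=; apply: eq_bigr => r _; rewrite mderivD mulrDr.
rewrite mulr_suml mulr_sumr -big_split /=; apply: eq_bigr => r _.
by rewrite mderivM; ring.
Qed.

Lemma St_linear i c (f g : P) : St i (c *: f + g) = c *: St i f + St i g.
Proof.
rewrite /St scaler_sumr -big_split /=; apply: eq_bigr => r _.
by rewrite mderivD mderivZ mulrDr scalerAr.
Qed.

Lemma StX i (r : 'I_n) : St i 'X_r = 'X_r ^+ (p ^ i).
Proof.
rewrite /St (bigD1 r) //= big1 => [|s sr].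
  rewrite mderivX mnmE eqxx scale1r addr0.
  suff -> : (U_(r) - U_(r) = 0)%MM by rewrite mpolyX0 mulr1.
  by apply/mnmP => k; rewrite !mnmE subnn.
by rewrite mderivX mnmE eq_sym (negPf sr) scale0r mulr0.
Qed.

Lemma St_unique i (D : P -> P) :
  is_derivation D -> (forall r, D 'X_r = 'X_r ^+ (p ^ i)) -> D =1 St i.
Proof.
move=> hD DX; have hS := St_derivation i.
apply: (@mpoly_skew_der_ext idfun _ _ hD.1 hS.1 hD.2 hS.2) => r.
by rewrite DX StX.
Qed.
End PolyDerivation.

Section Dickson.
Variables (p n : nat).
Local Notation P := {mpoly 'F_p[n]}.

(* The linear substitution x_r |-> \sum_s g_rs x_s. *)
Definition mx_act (g : 'M['F_p]_n) (f : P) : P :=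
  f \mPo [tuple \sum_(s < n) g r s *: 'X_s | r < n].

Lemma mx_act_zmod_morphism g : zmod_morphism (mx_act g).
Proof. by move=> x y; rewrite /mx_act raddfB. Qed.

Lemma mx_act_monoid_morphism g : monoid_morphism (mx_act g).
Proof. by split=> [|x y]; rewrite /mx_act ?rmorph1 ?rmorphM. Qed.

HB.instance Definition _ g :=
  GRing.isZmodMorphism.Build P P (mx_act g) (mx_act_zmod_morphism g).
HB.instance Definition _ g :=
  GRing.isMonoidMorphism.Build P P (mx_act g) (mx_act_monoid_morphism g).

Lemma mx_actX g r : mx_act g 'X_r = \sum_(s < n) g r s *: 'X_s.
Proof. by rewrite /mx_act comp_mpolyXU nth_mktuple. Qed.

Lemma mx_actC g c : mx_act g c%:MP = c%:MP.
Proof. exact: comp_mpolyC. Qed.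

Definition dickson_pred : {pred P} := fun f =>
  [forall g : 'M['F_p]_n, (g \in unitmx) ==> (mx_act g f == f)].

Lemma dickson_predP (f : P) :
  reflect (forall g, g \in unitmx -> mx_act g f = f) (f \in dickson_pred).
Proof.
apply: (iffP forallP) => H g; last by apply/implyP => /H ->.
by move=> ug; apply/eqP; have /implyP := H g; apply.
Qed.

Lemma dickson_divring_closed : divring_closed dickson_pred.
Proof.
split=> [|x y /dickson_predP hx /dickson_predP hy
         |x y /dickson_predP hx /dickson_predP hy];
  apply/dickson_predP => g ug; first by rewrite rmorph1.
  by rewrite rmorphB /= hx // hy.
rewrite rmorphM /= hx //; congr (_ * _).
have [uy|ny] := boolP (y \is a GRing.unit); first by rewrite rmorphV //= hy.
by rewrite invr_out // hy.
Qed.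

HB.instance Definition _ :=
  GRing.isDivringClosed.Build P dickson_pred dickson_divring_closed.

(* D_n, the GL_n(F_p)-invariants of F_p[x_1, ..., x_n]. *)
Record dickson :=
  Dickson { dickson_val :> P; dickson_valP : dickson_val \in dickson_pred }.

HB.instance Definition _ := [isSub for dickson_val].
HB.instance Definition _ := [Choice of dickson by <:].
HB.instance Definition _ := [SubChoice_isSubIntegralDomain of dickson by <:].

(* [e_1, ..., e_n] = det (x_r ^ (p ^ e_s)). *)
Definition bracket_mx (e : 'I_n -> nat) : 'M[P]_n :=
  \matrix_(r, s) 'X_r ^+ (p ^ e s).
Definition bracket (e : 'I_n -> nat) : P := \det (bracket_mx e).

Definition Ln : P := bracket (fun j => j).
(* L_{n,s}: the exponents bump s 0 < bump s 1 < ... are 0, 1, ..., n with s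
   omitted. *)
Definition Lns (s : nat) : P := bracket (fun j => bump s j).
End Dickson.

Section DicksonPrime.
Variables (p n : nat) (p_pr : prime p).
Local Notation P := {mpoly 'F_p[n]}.

Lemma mpoly_pchar : p \in [pchar P].
Proof.
have := pchar_Fp p_pr; rewrite !inE => /andP[-> /eqP e] /=.
by rewrite -mpolyC_nat e mpolyC0.
Qed.

Lemma mpoly_sumXp (I : finType) (F : I -> P) e :
  (\sum_i F i) ^+ (p ^ e) = \sum_i F i ^+ (p ^ e).
Proof.
elim: e F => [|e IH] F.
  by rewrite expn0 expr1; apply: eq_bigr => i _; rewrite expr1.
rewrite expnSr exprM IH -(pFrobenius_autE mpoly_pchar) rmorph_sum.
by apply: eq_bigr => i _; rewrite /= pFrobenius_autE -exprM.
Qed.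

Lemma Fp_Xp (c : 'F_p) e : c ^+ (p ^ e) = c.
Proof.
elim: e => [|e IH]; first by rewrite expr1.
by rewrite expnSr exprM IH; have := expf_card c; rewrite card_Fp.
Qed.

Lemma mx_act_bracket (g : 'M['F_p]_n) (e : 'I_n -> nat) :
  mx_act g (bracket p e) = (\det g)%:MP * bracket p e.
Proof.
rewrite /bracket -(det_map_mx (mx_act g)) -(det_map_mx (@mpolyC n 'F_p)).
rewrite -det_mulmx; congr (\det _); apply/matrixP => r s; rewrite !mxE.
rewrite rmorphXn /= mx_actX mpoly_sumXp; apply: eq_bigr => t _.
by rewrite !mxE -mul_mpolyC exprMn -rmorphXn /= Fp_Xp.
Qed.

(* The coefficients of the monic p-polynomial vanishing at x_0 .. x_(k-1). *)
Lemma ppoly_coef (x : nat -> P) k : exists c : nat -> P, c k = 1 /\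
  forall r, (r < k)%N -> \sum_(s < k.+1) c s * x r ^+ (p ^ s) = 0.
Proof.
elim: k => [|k [c [ck hc]]]; first by exists (fun=> 1).
pose f y := \sum_(s < k.+1) c s * y ^+ (p ^ s).
pose t := f (x k) ^+ p.-1.
pose b s := if (s <= k)%N then c s else 0.
exists (fun s => (if s is s'.+1 then b s' ^+ p else 0) - t * b s); split.
  by rewrite /b leqnn ltnn ck expr1n mulr0 subr0.
have fE y : \sum_(s < k.+2) ((if s : nat is s'.+1 then b s' ^+ p else 0) - t * b s)
      * y ^+ (p ^ s) = f y ^+ p - t * f y.
  under eq_bigr => s _ do rewrite mulrBl; rewrite sumrB; congr (_ - _).
    rewrite big_ord_recl mul0r add0r.
    rewrite /f -[X in _ ^+ X](expn1 p) mpoly_sumXp.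
    apply: eq_bigr => s _; rewrite /= /bump /= /b -ltnS ltn_ord.
    by rewrite expn1 exprMn -exprM -expnSr.
  rewrite big_ord_recr /= {2}/b ltnn mulr0 mul0r addr0 mulr_sumr.
  by apply: eq_bigr => s _; rewrite /b -ltnS ltn_ord mulrA.
move=> r; rewrite fE ltnS leq_eqVlt => /predU1P[->|rk].
  by rewrite /t -exprSr prednK ?prime_gt0 // subrr.
by rewrite [f _]hc // expr0n mulr0 subr0 eqn0Ngt prime_gt0.
Qed.

Lemma Lns_dvd s : exists q : P, Lns p n s = q * Ln p n.
Proof.
pose x r : P := if insub r is Some r' then 'X_r' else 0.
have xE (r : 'I_n) : x r = 'X_r by rewrite /x valK.
have [c [cn hc]] := ppoly_coef x n.
pose C : 'M[P]_n := \matrix_(t, j)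
  if (bump s j < n)%N then ((t : nat) == bump s j)%:R else - c t.
exists (\det C); rewrite mulrC -det_mulmx; congr (\det _).
apply/matrixP => r j; rewrite !mxE.
have [lt|ge] := ltnP (bump s j) n.
  rewrite (bigD1 (Ordinal lt)) //= big1 => [|t tE].
    by rewrite !mxE lt eqxx mulr1 addr0.
  by rewrite !mxE lt -[_ == _]/(t == Ordinal lt) (negPf tE) mulr0.
have jE : bump s j = n.
  apply/eqP; rewrite eqn_leq ge andbT /bump.
  by case: (s <= j)%N; rewrite ?add1n ?add0n // ltnW.
rewrite jE; have := hc r (ltn_ord r); rewrite big_ord_recr /= cn mul1r xE.
rewrite addrC => /eqP; rewrite addr_eq0 => /eqP ->.
rewrite -sumrN; apply: eq_bigr => t _.
by rewrite !mxE ltnNge ge /= mulrN mulrC.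
Qed.

Lemma Ln_neq0 : Ln p n != 0.
Proof.
rewrite /Ln /bracket -det_tr; apply/det0P => -[v v0 vM].
pose f : {poly P} := \sum_(s < n) v 0 s *: 'X^(p ^ s).
have p1 := prime_gt1 p_pr.
have fE y : f.[y] = \sum_(s < n) v 0 s * y ^+ (p ^ s).
  by rewrite horner_sum; apply: eq_bigr => s _; rewrite hornerZ hornerXn.
have f0 : f != 0.
  apply: contraNneq v0 => f0; apply/eqP/rowP => s; rewrite mxE.
  have := congr1 (fun g : {poly P} => g`_(p ^ s)) f0.
  rewrite coef0 coef_sum (bigD1 s) //= big1 => [|t ts].
    by rewrite coefZ coefXn eqxx mulr1 addr0.
  by rewrite coefZ coefXn eqn_exp2l // eq_sym -[_ == _]/(t == s) (negPf ts) mulr0.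
pose l (w : 'rV['F_p]_n) : P := \sum_(r < n) (w 0 r)%:MP * 'X_r.
have l_inj : injective l.
  move=> w w' e; apply/rowP => r; have := congr1 (mcoeff U_(r)%MM) e.
  rewrite !raddf_sum /=.
  have H (u : 'rV['F_p]_n) :
      \sum_(i < n) ((u 0 i)%:MP * 'X_i : P)@_U_(r) = u 0 r.
    rewrite (bigD1 r) //= big1 => [|t tr]; rewrite mcoeffCM mcoeffXU.
      by rewrite eqxx mulr1 addr0.
    by rewrite (negPf tr) mulr0.
  by rewrite !H.
have := max_poly_roots f0 (rs := [seq l w | w <- enum 'rV['F_p]_n]).
rewrite map_inj_uniq // enum_uniq size_map -cardE card_mx card_Fp // mul1n.
have -> : all (root f) [seq l w | w <- enum 'rV['F_p]_n].
  apply/allP => _ /mapP[w _ ->]; rewrite /root fE.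
  under eq_bigr => s _.
    rewrite mpoly_sumXp mulr_sumr; under eq_bigr => r _.
      rewrite exprMn -rmorphXn /= Fp_Xp mulrCA; over.
    over.
  rewrite exchange_big big1 // => r _; rewrite -mulr_sumr.
  have := congr1 (fun m : 'M__ => m 0 r) vM; rewrite !mxE.
  under eq_bigr => s _ do rewrite !mxE.
  by move=> ->; rewrite mulr0.
move=> /(_ isT isT); rewrite ltnNge => /negP; apply.
apply: (leq_trans (size_sum _ _ _)); apply/bigmax_leqP => s _.
rewrite (leq_trans (size_scale_leq _ _)) // size_polyXn.
by rewrite ltn_exp2l.
Qed.

Lemma dicksonQ_ex s : exists q : dickson p n,
  FracField.tofrac (val q) ==
  FracField.tofrac (Lns p n s) / FracField.tofrac (Ln p n).
Proof.
have [q qE] := Lns_dvd s.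
suff qP : q \in @dickson_pred p n.
  exists (Dickson qP); rewrite qE tofracM mulfK // tofrac_eq0; exact: Ln_neq0.
apply/dickson_predP => g ug.
have dg : (\det g)%:MP * Ln p n != 0.
  by rewrite mulf_neq0 ?Ln_neq0 // mpolyC_eq0 -unitfE.
have eL : mx_act g (Ln p n) = (\det g)%:MP * Ln p n := mx_act_bracket g _.
have eS : mx_act g (Lns p n s) = (\det g)%:MP * Lns p n s :=
  mx_act_bracket g _.
apply: (mulIf dg); rewrite -{1}eL mulrCA -qE -eS.
by rewrite qE rmorphM.
Qed.

(* The Dickson invariant Q_{n,s} = L_{n,s} / L_n; it is 1 for s >= n. *)
Definition dicksonQ (s : nat) : dickson p n := xchoose (dicksonQ_ex s).

Lemma dicksonQE s : FracField.tofrac (val (dicksonQ s)) =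
  FracField.tofrac (Lns p n s) / FracField.tofrac (Ln p n).
Proof. exact/eqP/(xchooseP (dicksonQ_ex s)). Qed.

Lemma dicksonQ_mulL s : val (dicksonQ s) * Ln p n = Lns p n s.
Proof.
apply/eqP; rewrite -tofrac_eq tofracM dicksonQE divfK // tofrac_eq0.
exact: Ln_neq0.
Qed.

Lemma St_mx_act i g (f : P) : mx_act g (St i f) = St i (mx_act g f).
Proof.
have [aS mS] := St_derivation p n i; move: f.
apply: (@mpoly_skew_der_ext p n (mx_act g)) => [x y|x y|x y|x y|r].
- by rewrite aS rmorphD.
- by rewrite rmorphD aS.
- by rewrite mS rmorphD !rmorphM.
- by rewrite rmorphM mS.
rewrite StX rmorphXn /= mx_actX mpoly_sumXp.
rewrite (big_morph (St i) aS (der0 (St_derivation p n i))).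
apply: eq_bigr => s _; rewrite -[X in St i X]addr0 St_linear StX.
by rewrite (der0 (St_derivation p n i)) addr0 exprZn Fp_Xp.
Qed.

Lemma St_dickson i (f : dickson p n) : St i (val f) \in @dickson_pred p n.
Proof.
apply/dickson_predP => g ug.
by rewrite St_mx_act (dickson_predP _ (valP f)).
Qed.

Definition StD i (f : dickson p n) : dickson p n := Dickson (St_dickson i f).

Lemma StD_val i f : val (StD i f) = St i (val f).
Proof. by []. Qed.

Lemma StD_derivation i : is_derivation (StD i).
Proof.
have [aS mS] := St_derivation p n i.
split=> x y; apply/val_inj; first exact: aS.
by rewrite StD_val raddfD !rmorphM /= mS.
Qed.

Definition dickson_loc := localization (dicksonQ 0).

Lemma Lns0 : Lns p n 0 = Ln p n ^+ p.
Proof.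
rewrite -(pFrobenius_autE mpoly_pchar) /Ln /Lns /bracket -det_map_mx.
congr (\det _); apply/matrixP => r s; rewrite !mxE /= pFrobenius_autE -exprM.
by rewrite -expnSr.
Qed.

Lemma dicksonQ0E : val (dicksonQ 0) = Ln p n ^+ p.-1.
Proof.
apply: (mulIf Ln_neq0); rewrite dicksonQ_mulL Lns0 -exprSr prednK //.
exact: prime_gt0.
Qed.

Lemma dicksonQ0_neq0 : dicksonQ 0 != 0.
Proof.
apply/eqP => /(congr1 val) /eqP; rewrite dicksonQ0E.
by apply/negP; rewrite expf_neq0 // Ln_neq0.
Qed.

Definition StL i : dickson_loc -> dickson_loc := loc_der (StD i).

Lemma StL_inj i f :
  StL i (loc_inj (dicksonQ 0) f) = loc_inj (dicksonQ 0) (StD i f).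
Proof. exact (loc_der_inj dicksonQ0_neq0 (StD_derivation i) f). Qed.

Lemma StL_derivation i : is_derivation (StL i).
Proof. exact (loc_der_derivation dicksonQ0_neq0 (StD_derivation i)). Qed.

Lemma StL_unique i (D : dickson_loc -> dickson_loc) :
  is_derivation D ->
  (forall f, D (loc_inj (dicksonQ 0) f) = loc_inj (dicksonQ 0) (StD i f)) ->
  D =1 StL i.
Proof.
move=> hD DE.
exact (loc_der_unique dicksonQ0_neq0 (StD_derivation i) hD DE).
Qed.

Definition delta i (z : dickson_loc) : dickson_loc :=
  (-1) ^+ n * loc_inv (dicksonQ 0) * StL i z.
End DicksonPrime.

Arguments StD {p n} p_pr i f.
Arguments StL {p n} p_pr i z.
Arguments delta {p n} p_pr i z.

(* Main.v *)
(** Since St^{Delta_i} kills p-th powers, it acts on a bracket only through the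
    column of exponent 0, which it turns into a column of exponent i:
    St^{Delta_i} L_{n,s} = [i, 1, ..., s^, ..., n], which for 0 < i, s <= n is
    (-1)^(i-1) L_{n,0} when s = i and has a repeated column otherwise. With
    L_n = L_{n,n}, both parts follow from the quotient rule for
    Q_{n,s} = L_{n,s} / L_n. *)

Require Import Defs.
From mathcomp Require Import all_boot all_order all_algebra.
From mathcomp Require Import mpoly ring.

Set Implicit Arguments.
Unset Strict Implicit.
Unset Printing Implicit Defensive.

Import GRing.Theory.
Local Open Scope ring_scope.

(** * Derivations of commutative rings *)

Lemma der_sign (R : comPzRingType) (d : R -> R) (hd : is_derivation d) k x :
  d ((-1) ^+ k * x) = (-1) ^+ k * d x.
Proof. by rewrite -signr_odd; case: odd; rewrite ?mulN1r ?derN ?mul1r. Qed.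

Lemma der_sum (R : comPzRingType) (d : R -> R) (hd : is_derivation d)
    (I : finType) (F : I -> R) :
  d (\sum_i F i) = \sum_i d (F i).
Proof. exact: (big_morph d hd.1 (der0 hd)). Qed.

Lemma der_natl (R : comPzRingType) (d : R -> R) (hd : is_derivation d) k x :
  d (k%:R * x) = k%:R * d x.
Proof.
by elim: k => [|k IH]; rewrite ?mul0r ?der0 // -nat1r !mulrDl hd.1 IH !mul1r.
Qed.

(** In [c ^+ k * x] each of the k + 1 factors gains one factor [c] under [d], so each application
    contributes the next integer, and these multiply to the factorial. *)
Lemma iter_der_fact (R : comPzRingType) (d : R -> R) (hd : is_derivation d)
    (c x : R) m :
  d c = c ^+ 2 -> d x = c * x -> iter m d x = (m`!)%:R * c ^+ m * x.
Proof.
move=> dc dx; have dcX k : d (c ^+ k * x) = k.+1%:R * c ^+ k.+1 * x.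
  elim: k => [|k IH]; first by rewrite !mul1r dx.
  by rewrite {1}exprS -mulrA hd.2 dc IH -[k.+2%:R]nat1r !exprS; ring.
elim: m => [|m IH]; first by rewrite !mul1r.
by rewrite iterS IH -mulrA der_natl // dcX factS natrM; ring.
Qed.

(** The kernel of a derivation is closed under sums, products and signs, hence under the Leibniz
    expansion. *)
Lemma der_det0 (R : comNzRingType) (d : R -> R) (hd : is_derivation d) m
    (A : 'M[R]_m) :
  (forall r s, d (A r s) = 0) -> d (\det A) = 0.
Proof.
move=> dA; rewrite /determinant der_sum // big1 // => u _.
rewrite der_sign // (big_ind (fun x => d x = 0)) ?mulr0 ?der1 // => x y dx dy.
by rewrite hd.2 dx dy mul0r mulr0 addr0.
Qed.

(** * Action of St on brackets *)

Section Brackets.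
Variables (p : nat) (p_pr : prime p).

Lemma St_Xpexp n i e (f : {mpoly 'F_p[n]}) :
  (0 < e)%N -> St i (f ^+ (p ^ e)) = 0.
Proof.
case: e => // e _; have [->|f0] := eqVneq f 0.
  by rewrite expr0n expn_eq0 eqn0Ngt prime_gt0 //= (der0 (St_derivation p n i)).
(* [derX] computes the derivative of a power only up to a factor of its base, here f^(p^e), which is
   cancelled in the domain; hence the separate case f = 0. *)
apply: (mulfI (expf_neq0 (p ^ e) f0)).
rewrite expnSr exprM (derX (St_derivation p n i)).
by rewrite (pcharf0 (mpoly_pchar n p_pr)) !mul0r mulr0.
Qed.

Lemma bracket_eq n (e e' : 'I_n -> nat) : e =1 e' -> bracket p e = bracket p e'.
Proof. by move=> ee; congr (\det _); apply/matrixP => r s; rewrite !mxE ee. Qed.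

Lemma bracket_repeat n (e : 'I_n -> nat) j k :
  j != k -> e j = e k -> bracket p e = 0.
Proof.
move=> jk ejk; rewrite /bracket -det_tr; apply: (determinant_alternate jk) => r.
by rewrite !mxE ejk.
Qed.

(** Carrying column 0 past [j] columns: the two cofactor expansions, along columns 0 and [j], have
    the same minors, and their signs differ by (-1)^j. *)
Lemma bracket_move n (e e' : 'I_n.+1 -> nat) j :
    e ord0 = e' j -> (forall k, e (lift ord0 k) = e' (lift j k)) ->
  bracket p e = (-1) ^+ j * bracket p e'.
Proof.
move=> e0 ek; rewrite /bracket (expand_det_col _ ord0) (expand_det_col _ j).
rewrite mulr_sumr; apply: eq_bigr => r _.
rewrite [RHS]mulrCA ![bracket_mx _ _ _ _]mxE e0.
congr (_ * _); rewrite /cofactor addn0 [(r + j)%N]addnC exprD -mulrA signrMK.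
congr (_ * \det _).
by apply/matrixP => k l; rewrite !mxE ek.
Qed.

Lemma St_bracket_gt0 n i (e : 'I_n -> nat) :
  (forall j, 0 < e j)%N -> St i (bracket p e) = 0.
Proof.
move=> e0; apply: (der_det0 (St_derivation p n i)) => r s.
by rewrite mxE St_Xpexp.
Qed.

(** Expand along column 0: the cofactors involve only p-th powers and behave as constants. *)
Lemma St_bracket n i (e : 'I_n.+1 -> nat) :
    e ord0 = 0%N -> (forall k, 0 < e (lift ord0 k))%N ->
  St i (bracket p e) = bracket p (fun j => if j == ord0 then i else e j).
Proof.
move=> e0 ek; have hS := St_derivation p n.+1 i.
rewrite /bracket !(expand_det_col _ ord0) (der_sum hS).
apply: eq_bigr => r _; rewrite hS.2 ![bracket_mx _ _ _ _]mxE e0 eqxx expr1 StX.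
have -> : St i (cofactor (bracket_mx p e) r ord0) = 0.
  rewrite (der_sign hS) (der_det0 hS) ?mulr0 // => k l.
  by rewrite !mxE St_Xpexp.
rewrite mulr0 addr0; congr (_ * (_ * \det _)).
by apply/matrixP => k l; rewrite !mxE.
Qed.

Lemma LnE n : Ln p n = Lns p n n.
Proof. by apply: bracket_eq => j; rewrite /bump leqNgt ltn_ord. Qed.

Lemma St_Lns0 n i : St i (Lns p n 0) = 0.
Proof. exact: St_bracket_gt0. Qed.

Lemma St_Lns n i s : (0 < i <= n)%N -> (0 < s <= n)%N ->
  St i (Lns p n s) = if s == i then (-1) ^+ i.-1 * Lns p n 0 else 0.
Proof.
case: n => [|n]; first by case: i.
case/andP=> i0 iln /andP[s0 sln].
rewrite [Lns _ _ s]/Lns St_bracket /=; first last.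
- by move=> k; rewrite /bump; case: (s <= _)%N.
- by rewrite /bump leqNgt s0.
have [->|si] := eqVneq s i.
  (* The leading exponent i has to pass 1, ..., i-1 to restore the increasing order of [Lns] at 0,
     so it lands at position i-1. *)
  have ij : (i.-1 < n.+1)%N by rewrite prednK.
  apply: (@bracket_move n _ _ (Ordinal ij)) => [|k] /=.
    by rewrite /bump leq0n add1n prednK.
  by rewrite /bump /= !add1n addnS -[(i.-1 <= k)%N]ltnS prednK.
(* [unbump s i] is the position of the exponent i in L_{n,s}. It is not 0, since position 0 holds
   the exponent 0 when s > 0; so it repeats the new column 0. *)
have ub : (unbump s i < n.+1)%N.
  by rewrite /unbump; case: (ltnP s i) => h;
    rewrite ?subn1 ?subn0 ?prednK // (leq_trans _ sln) // ltn_neqAle eq_sym si.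
have b : bump s (unbump s i) = i by rewrite unbumpK // inE eq_sym.
apply: (@bracket_repeat _ _ ord0 (Ordinal ub)).
  apply/eqP => /(congr1 val) /= u0; move: b; rewrite -u0 /bump leqNgt s0 => ie.
  by rewrite -ie in i0.
rewrite eqxx; case: eqP => // _; by rewrite b.
Qed.

Lemma St_Ln n i : (0 < i <= n)%N ->
  St i (Ln p n) = if n == i then (-1) ^+ i.-1 * Lns p n 0 else 0.
Proof.
move=> hi; rewrite LnE St_Lns // leqnn andbT.
by case/andP: hi; apply: leq_trans.
Qed.

End Brackets.

(** * Action on the Dickson invariants *)

Section DicksonInvariants.
Variables (p n : nat) (p_pr : prime p).
Local Notation Q := (dicksonQ n p_pr).

(** The quotient rule with one denominator cleared, obtained by differentiating Q_{n,s} L_n =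
    L_{n,s}; it stays inside the polynomial ring. *)
Lemma St_dicksonQ i s a b : St i (Lns p n s) = a -> St i (Ln p n) = b ->
  St i (val (Q s)) * Ln p n = a - val (Q s) * b.
Proof.
move=> <- <-; apply/eqP; rewrite eq_sym subr_eq; apply/eqP.
by rewrite -(St_derivation p n i).2 dicksonQ_mulL.
Qed.

(** For i < n the denominator L_n is killed, so only the numerator contributes. *)
Lemma StD_dicksonQ_lt i s : (0 < i < n)%N -> (s < n)%N ->
  StD p_pr i (Q s) = if s == i then (-1) ^+ i.-1 * Q 0 else 0.
Proof.
move=> /andP[i0 lin] lsn; apply/val_inj/(mulIf (Ln_neq0 n p_pr)).
have iin : (0 < i <= n)%N by rewrite i0 ltnW.
have eL : St i (Ln p n) = 0 by rewrite St_Ln // gtn_eqF.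
case: s lsn => [|s] lsn.
  by rewrite (St_dicksonQ (St_Lns0 _ _ _) eL) // mulr0 subr0 ltn_eqF // mul0r.
rewrite (St_dicksonQ (St_Lns _ _ _) eL) ?(ltnW lsn) // mulr0 subr0.
case: eqP => _; last by rewrite mul0r.
by rewrite rmorphM rmorph_sign /= -mulrA dicksonQ_mulL.
Qed.

(** Now the numerator is killed and L_n goes to (-1)^(n-1) Q_{n,0} L_n; the minus sign of the
    quotient rule turns this into (-1)^n. *)
Lemma StD_dicksonQ_n s : (0 < n)%N -> (s < n)%N ->
  StD p_pr n (Q s) = (-1) ^+ n * Q 0 * Q s.
Proof.
move=> n0 lsn; apply/val_inj/(mulIf (Ln_neq0 n p_pr)).
have nn : (0 < n <= n)%N by rewrite n0 leqnn.
have eS : St n (Lns p n s) = 0.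
  case: s lsn => [|s] lsn; first exact: St_Lns0.
  by rewrite St_Lns ?(ltnW lsn) // ltn_eqF.
have := St_Ln p_pr nn; rewrite eqxx => eL.
rewrite (St_dicksonQ eS eL) -(dicksonQ_mulL n p_pr 0) !rmorphM rmorph_sign /=.
have -> : (-1) ^+ n = - (-1) ^+ n.-1 :> {mpoly 'F_p[n]}.
  by rewrite -[- _ ^+ _]mulN1r -exprS prednK.
suff algE (a b c e : {mpoly 'F_p[n]}) : 0 - a * (e * (b * c)) = - e * b * a * c.
  exact: algE.
ring.
Qed.

Lemma iter_StD_dicksonQ_n s m : (0 < n)%N -> (s < n)%N ->
  iter m (StD p_pr n) (Q s) = (-1) ^+ (m * n) * (m`!)%:R * Q 0 ^+ m * Q s.
Proof.
move=> n0 lsn; have hS := StD_derivation n p_pr n.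
rewrite (iter_der_fact hS (c := (-1) ^+ n * Q 0)).
- by rewrite exprMn -exprM [(n * m)%N]mulnC mulrA [_%:R * _]mulrC.
(* The case s = 0 of the formula says that c = (-1)^n Q_{n,0} satisfies d c = c^2. *)
- by rewrite (der_sign hS) StD_dicksonQ_n // expr2 mulrACA !mulrA.
- exact: StD_dicksonQ_n.
Qed.

(** * The normalized derivations *)

Lemma delta_inj i f :
  delta p_pr i (loc_inj (Q 0) f) =
  loc_inv (Q 0) * loc_inj (Q 0) ((-1) ^+ n * StD p_pr i f).
Proof. by rewrite /delta StL_inj rmorphM rmorph_sign -mulrA mulrCA. Qed.

Lemma delta_sign i k : delta p_pr i ((-1) ^+ k : dickson_loc n p_pr) = 0.
Proof.
have hS := StL_derivation n p_pr i.
by rewrite /delta -[X in StL _ _ X]mulr1 (der_sign hS) (der1 hS) !mulr0.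
Qed.

Lemma delta0 i : delta p_pr i (0 : dickson_loc n p_pr) = 0.
Proof. by rewrite /delta (der0 (StL_derivation n p_pr i)) mulr0. Qed.

Lemma delta_dicksonQ_lt i s : (0 < i < n)%N -> (s < n)%N ->
  delta p_pr i (loc_inj (Q 0) (Q s)) =
  if s == i then (-1) ^+ (n + i - 1) else 0.
Proof.
move=> hi lsn; rewrite delta_inj StD_dicksonQ_lt //.
case: eqP => _; last by rewrite mulr0 raddf0 mulr0.
rewrite mulrA -exprD rmorphM rmorph_sign mulrCA loc_invK ?dicksonQ0_neq0 //.
(* As i > 0, the truncated n + i - 1 agrees with n + (i-1). *)
by case/andP: hi; case: i => // i _ _; rewrite mulr1 addnS subn1.
Qed.

Lemma delta_dicksonQ_n s : (0 < n)%N -> (s < n)%N ->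
  delta p_pr n (loc_inj (Q 0) (Q s)) = loc_inj (Q 0) (Q s).
Proof.
move=> n0 lsn; rewrite delta_inj StD_dicksonQ_n // !mulrA -exprD addnn.
rewrite -signr_odd odd_double mul1r rmorphM mulrA loc_invK ?mul1r //.
exact: dicksonQ0_neq0.
Qed.

End DicksonInvariants.

Theorem proposition4p1 (p n : nat) (p_pr : prime p) (p_odd : odd p)
    (n_gt0 : (0 < n)%N) :
  let Q (s : nat) : dickson p n := dicksonQ n p_pr s in
  let inj (f : dickson p n) : dickson_loc n p_pr := loc_inj (Q 0%N) f in
  (forall i : nat, (1 <= i < n)%N -> forall s : nat, (s < n)%N ->
    [/\ delta p_pr i (inj (Q s)) =
          (if s == i then (-1) ^+ (n + i - 1) else 0),
        (forall m : nat, (1 <= m)%N ->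
          iter m (delta p_pr i) (inj (Q s)) =
            (if (m == 1%N) && (s == i) then (-1) ^+ (n + i - 1) else 0))
      & (forall m : nat, (1 <= m)%N ->
          iter m (StD p_pr i) (Q s) =
            (if (m == 1%N) && (s == i) then (-1) ^+ (i - 1) * Q 0%N else 0))])
  /\
  (forall s : nat, (s < n)%N ->
    [/\ delta p_pr n (inj (Q s)) = inj (Q s),
        (forall m : nat, (1 <= m)%N ->
          iter m (delta p_pr n) (inj (Q s)) = inj (Q s)),
        (forall m : nat, (1 <= m)%N ->
          iter m (StD p_pr n) (Q s) =
            (-1) ^+ (m * n) * (m`!)%:R * Q 0%N ^+ m * Q s)
      & (forall m : nat, (p <= m)%N -> iter m (StD p_pr n) (Q s) = 0)]).
Proof.
move=> Q inj; split=> [i hi s lsn|s lsn].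
  (* Since i > 0, Q_{n,0} is itself killed, and so is the multiple of it produced by the first
     application. *)
  have St0 : StD p_pr i (Q 0%N) = 0.
    by rewrite StD_dicksonQ_lt // ?ltn_eqF //; case/andP: hi.
  have hS := StD_derivation n p_pr i.
  split; first exact: delta_dicksonQ_lt.
  (* For m >= 2, the first application leaves a sign or 0, the second kills it, and the remaining
     ones fix 0. *)
  - case=> [|[|m]] // _; first exact: delta_dicksonQ_lt.
    rewrite !iterSr delta_dicksonQ_lt //.
    suff -> : delta (n := n) p_pr i
        (if s == i then (-1) ^+ (n + i - 1) else 0) = 0.
      exact/iter_fix/delta0.
    by case: eqP => _; rewrite ?delta_sign ?delta0.
  - case=> [|[|m]] // _; first by rewrite /= StD_dicksonQ_lt // subn1.
    rewrite !iterSr StD_dicksonQ_lt //.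
    suff -> : StD p_pr i (if s == i then (-1) ^+ i.-1 * Q 0%N else 0) = 0.
      exact/iter_fix/der0.
    by case: eqP => _; rewrite ?(der_sign hS) ?St0 ?mulr0 ?(der0 hS).
have fixed := delta_dicksonQ_n p_pr n_gt0 lsn.
split=> // m lem; last first.
- rewrite iter_StD_dicksonQ_n //.
  (* From m = p on, the factorial contains the factor p and vanishes in characteristic p. *)
  have pm : (p %| m`!)%N by rewrite dvdn_fact // prime_gt0.
  have -> : (m`!)%:R = 0 :> dickson p n.
    apply/val_inj; rewrite rmorph_nat raddf0; apply/eqP.
    by rewrite -(dvdn_pcharf (mpoly_pchar n p_pr)).
  by rewrite mulr0 !mul0r.
- exact: iter_StD_dicksonQ_n.
- exact: iter_fix.
Qed.
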